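(* Let $N\ge M\ge2$. Every real $M\times N$ unit norm frame has worst-case coherence $$\mu\ge\cos\left[\pi\left(\frac{M-1}{N\pi^{1/2}}\cdot\frac{\Gamma(\frac{M-1}{2})}{\Gamma(\frac M2)}\right)^{\frac1{M-1}}\right].$$ Furthermore, taking $N=\Theta(a^M)$ (for a constant $a>1$), this lower bound goes to $\cos(\frac{\pi}{a})$ as $M\to\infty$.
   Context: A real $M\times N$ unit norm frame is a real $M\times N$ matrix $\Phi=[\varphi_1\cdots\varphi_N]$ of rank $M$ with unit-norm columns. Its worst-case coherence is $\mu:=\max_{i\ne j}|\langle\varphi_i,\varphi_j\rangle|$. $\Gamma$ is the Gamma function. *)

(* Defs.v *)
From HB Require Import structures.
From mathcomp Require Import all_boot all_order all_algebra.
From mathcomp Require Import all_classical all_reals all_analysis.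

Set Implicit Arguments.
Unset Strict Implicit.
Unset Printing Implicit Defensive.

Import Order.TTheory GRing.Theory Num.Theory.
Import numFieldNormedType.Exports.

Local Open Scope classical_set_scope.
Local Open Scope ring_scope.

(* Euler's integral converges only for s > 0, the sole range of interest. *)
Definition Gamma (R : realType) (s : R) : R :=
  \int[@lebesgue_measure R]_(t in `]0, +oo[) (t `^ (s - 1) * expR (- t)).

Definition dotp (R : realType) (M : nat) (u v : 'cV[R]_M) : R :=
  \sum_(k < M) u k 0 * v k 0.

(* The library norm on matrices is the max norm, hence this definition. *)
Definition l2norm (R : realType) (M : nat) (u : 'cV[R]_M) : R :=
  Num.sqrt (dotp u u).

Definition unit_norm_frame (R : realType) (M N : nat) (Phi : 'M[R]_(M, N)) : Prop :=
  \rank Phi = M /\ (forall j : 'I_N, l2norm (col j Phi) = 1).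

(* The initial value 0 is harmless: the terms are nonnegative, and there is at
   least one of them as soon as N >= 2. *)
Definition worst_case_coherence (R : realType) (M N : nat) (Phi : 'M[R]_(M, N)) : R :=
  \big[Num.max/0]_(p : 'I_N * 'I_N | p.1 != p.2)
    `|dotp (col p.1 Phi) (col p.2 Phi)|.

Definition coherence_bound (R : realType) (M N : nat) : R :=
  cos (pi * ((M%:R - 1) / (N%:R * Num.sqrt pi)
             * (Gamma ((M%:R - 1) / 2) / Gamma (M%:R / 2)))
            `^ (1 / (M%:R - 1))).

(* Main.v *)
Require Import Defs.
From HB Require Import structures.
From mathcomp Require Import all_boot all_order all_algebra.
From mathcomp Require Import all_classical all_reals all_analysis.
From mathcomp Require Import measurable_realfun.
From mathcomp Require Import ring lra.

Set Implicit Arguments.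
Unset Strict Implicit.
Unset Printing Implicit Defensive.

Import Order.TTheory GRing.Theory Num.Theory.
Import numFieldNormedType.Exports.

Local Open Scope classical_set_scope.
Local Open Scope ring_scope.

(** Write the worst-case coherence as cos theta with 0 <= theta <= pi/2.  Two
    double caps of angular radius theta/2, centred at the lines spanned by two
    distinct columns, do not meet on the unit sphere: a common point would put
    these lines at an angle less than theta.  Hence N double caps fit on the
    sphere.  In the angle t to the centre the sphere has density
    proportional to sin^(M-2) t, so this reads

      N * int_0^(theta/2) sin^(M-2)  <=  int_0^(pi/2) sin^(M-2).

    The inequality sin t >= 2t/pi bounds the left-hand side from below and gives
    N (theta/pi)^(M-1) / (M-1) <= W, where W is the mean of sin^(M-2) on
    [0, pi/2] ([cap_packing]).  Since Gamma((M-1)/2) / Gamma(M/2) = sqrt pi * W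
    ([Gamma_ratio]), the right-hand side of the theorem is cos (pi * B) with
    B^(M-1) = (M-1) W / N, and the packing inequality says theta <= pi * B.
    The hypothesis M <= N enters here: it gives B <= 1, so that pi * B stays in
    the interval where the cosine decreases.

    The uniform measure of the sphere is only used through limits of finite
    sums.  [sphere_sum n] is a product of Riemann sums in spherical coordinates:
    a positive linear functional on all functions, which is not invariant under
    rotations, but whose value at x |-> <x, phi>^(2p) tends, as n grows, to a
    quantity that depends on the norm of phi only ([sphere_sum_cvg]).  That is
    as much invariance as the packing argument needs, because the indicator
    function of a double cap can be replaced by a polynomial in <x, phi>^2 that is
    close to 1 well inside the cap, close to 0 outside it, and between 0 and 1
    everywhere ([poly_step]).  All the one-dimensional limits come from a single
    fact, namely that the Riemann means of a derivative converge
    ([quarter_mean_derive]).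

    For the asymptotic statement, 2 / (pi (M-1)) <= W <= 1 shows that
    ln B = ln ((M-1) W / N) / (M-1) tends to - ln a when N is of the exact order
    of a^M; hence pi * B tends to pi / a. *)

(** * Riemann means over a quarter period *)

Section RiemannMeans.
Variable R : realType.
Implicit Types (f g F : R -> R) (n : nat).

Definition quarter_mean n f : R :=
  (\sum_(i < n.+1) f (pi / 2 * (i%:R / n.+1%:R))) / n.+1%:R.

Lemma quarter_mean_scale n c f :
  quarter_mean n (fun t => c * f t) = c * quarter_mean n f.
Proof. by rewrite /quarter_mean -mulr_sumr mulrA. Qed.

Lemma quarter_meanD n f g :
  quarter_mean n (fun t => f t + g t) = quarter_mean n f + quarter_mean n g.
Proof. by rewrite /quarter_mean big_split mulrDl. Qed.

Lemma quarter_mean_sum n m (f : 'I_m -> R -> R) :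
  quarter_mean n (fun t => \sum_(j < m) f j t) = \sum_(j < m) quarter_mean n (f j).
Proof. by rewrite /quarter_mean exchange_big mulr_suml. Qed.

Lemma eq_quarter_mean n f g : f =1 g -> quarter_mean n f = quarter_mean n g.
Proof. by move=> fg; congr (_ / _); apply: eq_bigr => i _; rewrite fg. Qed.

(** A product of Lipschitz functions is Lipschitz when they are bounded. *)
Definition bounded_lipschitz f :=
  exists2 K, 0 <= K &
    (forall x, `|f x| <= K) /\ (forall x y, `|f x - f y| <= K * `|x - y|).

Lemma bounded_lipschitz_cst c : bounded_lipschitz (fun=> c).
Proof.
exists `|c| => //; split=> // x y.
by rewrite subrr normr0 mulr_ge0.
Qed.

Lemma bounded_lipschitzD f g :
  bounded_lipschitz f -> bounded_lipschitz g ->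
  bounded_lipschitz (fun x => f x + g x).
Proof.
move=> [K K0 [Kb Kl]] [L L0 [Lb Ll]]; exists (K + L); first exact: addr_ge0.
split=> [x|x y]; first by rewrite (le_trans (ler_normD _ _))// lerD.
rewrite opprD addrACA (le_trans (ler_normD _ _))// mulrDl.
by rewrite lerD.
Qed.

Lemma bounded_lipschitzM f g :
  bounded_lipschitz f -> bounded_lipschitz g ->
  bounded_lipschitz (fun x => f x * g x).
Proof.
move=> [K K0 [Kb Kl]] [L L0 [Lb Ll]]; exists (K * L + K * L).
  by rewrite addr_ge0// mulr_ge0.
split=> [x|x y].
  by rewrite normrM ler_wpDl ?mulr_ge0// ler_pM.
have -> : f x * g x - f y * g y = f x * (g x - g y) + (f x - f y) * g y by ring.
rewrite (le_trans (ler_normD _ _))// !normrM mulrDl lerD//.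
  by rewrite -mulrA ler_pM.
by rewrite mulrAC ler_pM.
Qed.

Lemma bounded_lipschitzX f k :
  bounded_lipschitz f -> bounded_lipschitz (fun x => f x ^+ k).
Proof.
move=> fl; elim: k => [|k IH]; first exact: bounded_lipschitz_cst.
under eq_fun do rewrite exprS.
exact: bounded_lipschitzM.
Qed.

Lemma lipschitz_of_derive F f :
  (forall x : R, is_derive x 1 F (f x)) -> (forall x, `|f x| <= 1) ->
  forall x y, `|F x - F y| <= `|x - y|.
Proof.
move=> dF f1 x y; wlog xy : x y / y <= x.
  move=> W; case: (leP y x) => [/W//|/ltW/W].
  by rewrite distrC (distrC x).
have cF : {within `[y, x], continuous F}.
  apply: derivable_within_continuous => z _; exact: ex_derive.
have [c _ ->] := MVT_segment xy (fun z _ => dF z) cF.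
by rewrite normrM ler_piMl.
Qed.

Lemma bounded_lipschitz_sin : bounded_lipschitz (@sin R).
Proof.
exists 1 => //; split=> [|x y]; first exact: sin_max.
rewrite mul1r; apply: (@lipschitz_of_derive _ cos) => // z; exact: cos_max.
Qed.

Lemma bounded_lipschitz_cos : bounded_lipschitz (@cos R).
Proof.
exists 1 => //; split=> [|x y]; first exact: cos_max.
rewrite mul1r; apply: (@lipschitz_of_derive _ (fun z => - sin z)) => // z.
by rewrite normrN sin_max.
Qed.

Lemma bounded_lipschitz_cosXsinX a b :
  bounded_lipschitz (fun t : R => cos t ^+ a * sin t ^+ b).
Proof.
apply: bounded_lipschitzM; apply: bounded_lipschitzX.
  exact: bounded_lipschitz_cos.
exact: bounded_lipschitz_sin.
Qed.

(** By the mean value theorem each summand differs from an increment of [F] by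
    O(n^-2), and the increments telescope. *)
Lemma quarter_mean_derive F f :
  (forall x : R, is_derive x 1 F (f x)) -> bounded_lipschitz f ->
  quarter_mean n f @[n --> \oo] --> (F (pi / 2) - F 0) / (pi / 2).
Proof.
move=> dF [K K0 [_ Kl]].
have h0 : 0 < pi / 2 :> R by rewrite divr_gt0 ?pi_gt0.
apply/cvgrPdist_le => /= e e0.
suff bnd n : `|(F (pi / 2) - F 0) / (pi / 2) - quarter_mean n f|
    <= K * (pi / 2) / n.+1%:R.
  near=> n; apply: (le_trans (bnd n)).
  rewrite ler_pdivrMr// -ler_pdivrMl//.
  apply: (@le_trans _ _ n%:R); last by rewrite ler_nat.
  near: n; exact: nbhs_infty_ger.
pose t (i : nat) : R := pi / 2 * (i%:R / n.+1%:R).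
have n0 : 0 < n.+1%:R :> R by [].
have tele : F (pi / 2) - F 0 = \sum_(i < n.+1) (F (t i.+1) - F (t i)).
  rewrite -(big_mkord xpredT (fun i => F (t i.+1) - F (t i))).
  rewrite telescope_sumr// /t divff ?gt_eqF// mulr1.
  by rewrite mul0r mulr0.
have tS i : t i.+1 - t i = pi / 2 / n.+1%:R.
  by rewrite /t -mulrBr -mulrBl -(natr1 i) addrAC subrr add0r mul1r.
have step (i : nat) :
    `|(F (t i.+1) - F (t i)) - pi / 2 / n.+1%:R * f (t i)|
    <= pi / 2 / n.+1%:R * (K * (pi / 2 / n.+1%:R)).
  have ti : t i <= t i.+1 by rewrite -subr_ge0 tS divr_ge0// ltW.
  have cF : {within `[t i, t i.+1], continuous F}.
    apply: derivable_within_continuous => z _; exact: ex_derive.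
  have [c cin ->] := MVT_segment ti (fun z _ => dF z) cF.
  rewrite tS (mulrC (f c)) -mulrBr normrM ger0_norm; last by rewrite divr_ge0 ?ltW.
  apply: ler_wpM2l; first by rewrite divr_ge0// ltW.
  apply: (le_trans (Kl _ _)); apply: ler_wpM2l => //.
  move: cin; rewrite in_itv/= => /andP[c1 c2].
  by rewrite ger0_norm ?subr_ge0// -(tS i) lerB.
have -> : (F (pi / 2) - F 0) / (pi / 2) - quarter_mean n f =
    (\sum_(i < n.+1) (F (t i.+1) - F (t i) - pi / 2 / n.+1%:R * f (t i)))
    / (pi / 2).
  rewrite sumrB -tele -mulr_sumr [RHS]mulrBl; congr (_ - _).
  rewrite /quarter_mean [RHS]mulrAC (mulrAC (pi / 2) _ (pi / 2)^-1).
  by rewrite divff ?gt_eqF// mul1r mulrC.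
rewrite normrM [X in _ * X]ger0_norm; last by rewrite invr_ge0 ltW.
rewrite ler_pdivrMr// (le_trans (ler_norm_sum _ _ _))//.
pose c := pi / 2 / n.+1%:R * (K * (pi / 2 / n.+1%:R)).
apply: (@le_trans _ _ (\sum_(i < n.+1) c)).
  by apply: ler_sum => i _; exact: step.
rewrite sumr_const card_ord -[X in X <= _]mulr_natl /c.
rewrite le_eqVlt; apply/orP; left; apply/eqP.
by move: n0; set m : R := n.+1%:R => n0; field; rewrite gt_eqF.
Unshelve. all: by end_near. Qed.

(** The mean of [sin ^+ d] over a quarter period, through its Wallis recurrence;
    [cvg_quarter_mean_sin] justifies the name. *)
Fixpoint wallis (d : nat) : R :=
  match d with
  | 0 => 1
  | 1 => 2 / pi
  | d'.+2 => d'.+1%:R / d'.+2%:R * wallis d'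
  end.

Lemma wallisSS d : wallis d.+2 = d.+1%:R / d.+2%:R * wallis d.
Proof. by []. Qed.

Lemma wallis_gt0 d : 0 < wallis d.
Proof.
elim/ltn_ind: d => -[_|[_|d IH]] //=; first by rewrite divr_gt0// pi_gt0.
by rewrite mulr_gt0 ?divr_gt0// IH.
Qed.

Lemma wallis_le1 d : wallis d <= 1.
Proof.
elim/ltn_ind: d => -[_|[_|d IH]] //.
  by rewrite /= ler_pdivrMr ?pi_gt0// mul1r pi_ge2.
rewrite wallisSS mulr_ile1 ?divr_ge0 ?(ltW (wallis_gt0 _))//; last exact: IH.
by rewrite ler_pdivrMr// mul1r ler_nat.
Qed.

(** The factors of two consecutive terms cancel in the recurrence. *)
Lemma wallis_mulS d : wallis d * wallis d.+1 = 2 / pi / d.+1%:R.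
Proof.
elim: d => [|d IH]; first by rewrite /= mul1r divr1.
rewrite wallisSS mulrCA (mulrC (wallis d.+1)) IH.
by rewrite mulrCA; congr (_ * _); rewrite -mulrA mulrC mulfVK// pnatr_eq0.
Qed.

Lemma wallis_ge d : 2 / pi / d.+1%:R <= wallis d.
Proof.
by rewrite -wallis_mulS ler_piMr ?wallis_le1// ltW// wallis_gt0.
Qed.

(** The mean of the [2p]-th power of a coordinate on the unit sphere of the
    [M]-dimensional space: the quotient of 1 * 3 * ... * (2p-1) by
    M * (M+2) * ... * (M+2p-2). *)
Definition sphere_moment (M p : nat) : R :=
  \prod_(i < p) ((i.*2.+1)%:R / (M + i.*2)%:R).

Let dcosXsinX a b (x : R) : is_derive x 1 (fun t => cos t ^+ a.+1 * sin t ^+ b.+1)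
   (b.+1%:R * (cos x ^+ a.+2 * sin x ^+ b)
    - a.+1%:R * (cos x ^+ a * sin x ^+ b.+2)).
Proof.
have dc := is_derive_cos x; have ds := is_derive_sin x.
rewrite (_ : (fun t => _) = (cos : R -> R) ^+ a.+1 * (sin : R -> R) ^+ b.+1);
  last first.
  by apply/funext => t; rewrite [in RHS]fctE !exprfctE.
apply: is_derive_eq.
rewrite /GRing.scale/= !exprfctE !exprS; ring.
Qed.

Let boundary a b :
  ((fun t : R => cos t ^+ a.+1 * sin t ^+ b.+1) (pi / 2)
   - (fun t : R => cos t ^+ a.+1 * sin t ^+ b.+1) 0) / (pi / 2) = 0.
Proof.
by cbv beta; rewrite cos_pihalf sin0 !expr0n /= mul0r mulr0 subrr mul0r.
Qed.

(** The derivative of [cos ^+ a.+1 * sin ^+ b.+1] has mean zero over a quarter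
    period.  Whenever it links two functions linearly, the limit of the means of
    one is therefore obtained from that of the other; the Wallis recurrences in
    [a] and in [b] are both of this form. *)
Lemma cvg_quarter_mean_step a b (f : R -> R) (p q r l : R) : q != 0 ->
  (forall x, q * f x = p * (cos x ^+ a * sin x ^+ b)
    + r * (b.+1%:R * (cos x ^+ a.+2 * sin x ^+ b)
    - a.+1%:R * (cos x ^+ a * sin x ^+ b.+2))) ->
  quarter_mean n (fun t => cos t ^+ a * sin t ^+ b) @[n --> \oo] --> l ->
  quarter_mean n f @[n --> \oo] --> p / q * l.
Proof.
move=> q0 fE cl.
pose h x := b.+1%:R * (cos x ^+ a.+2 * sin x ^+ b)
    - a.+1%:R * (cos x ^+ a * sin x ^+ b.+2) : R.
have hl : bounded_lipschitz h.
  apply: bounded_lipschitzD.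
    apply: bounded_lipschitzM; first exact: bounded_lipschitz_cst.
    exact: bounded_lipschitz_cosXsinX.
  under eq_fun do rewrite -mulNr.
  apply: bounded_lipschitzM; first exact: bounded_lipschitz_cst.
  exact: bounded_lipschitz_cosXsinX.
have ch := quarter_mean_derive (dcosXsinX a b) hl.
rewrite boundary in ch.
have -> : (fun n => quarter_mean n f) = (fun n => p / q *
    quarter_mean n (fun t => cos t ^+ a * sin t ^+ b) + r / q * quarter_mean n h).
  apply/funext => n; rewrite -!quarter_mean_scale -quarter_meanD.
  apply: eq_quarter_mean => x.
  apply: (mulfI q0); rewrite fE -/(h x); cbv beta.
  by move: (h x) (cos x ^+ a * sin x ^+ b) => u v; field.
rewrite -[p / q * l]addr0 -[X in _ + X](mulr0 (r / q)).
by apply: cvgD; apply: cvgZr.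
Qed.

Lemma cvg_quarter_mean_sin b :
  quarter_mean n (fun t => cos t ^+ 0 * sin t ^+ b) @[n --> \oo] --> wallis b.
Proof.
elim/ltn_ind: b => -[_|[_|b IH]].
- apply: (@cvg_trans _ ((fun=> 1 : R) @ \oo)); last exact: cvg_cst.
  apply: near_eq_cvg; near=> n; rewrite /quarter_mean.
  under eq_bigr do rewrite !expr0 mulr1.
  by rewrite sumr_const card_ord divff// pnatr_eq0.
- have dN (x : R) : is_derive x 1 (fun t => - cos t) (cos x ^+ 0 * sin x ^+ 1).
    have dc := is_derive_cos x; apply: is_derive_eq.
    by rewrite expr0 expr1 mul1r opprK.
  have := quarter_mean_derive dN (bounded_lipschitz_cosXsinX 0 1).
  by rewrite cos_pihalf cos0 opprK oppr0 add0r div1r invf_div.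
- rewrite wallisSS; apply: (@cvg_quarter_mean_step 0 b _ _ _ (-1)).
  + by rewrite pnatr_eq0.
  + move=> x; rewrite !expr0 !mul1r exprS exprS.
    rewrite (mulrA (sin x)) -expr2 sin2cos2 -!natr1; ring.
  + exact: IH.
Unshelve. all: by end_near. Qed.

Lemma cvg_quarter_mean_cos_sin b s :
  quarter_mean n (fun t => cos t ^+ s.*2 * sin t ^+ b) @[n --> \oo]
    --> wallis b * sphere_moment b.+2 s.
Proof.
elim: s => [|s IH].
  rewrite /sphere_moment big_ord0 mulr1; exact: cvg_quarter_mean_sin.
rewrite [X in _ --> X](_ : _ = s.*2.+1%:R / (b + s.*2).+2%:R
    * (wallis b * sphere_moment b.+2 s)); last first.
  rewrite /sphere_moment big_ord_recr [X in wallis b * X]mulrC.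
  by rewrite mulrCA.
apply: (cvg_quarter_mean_step (r := 1) _ _ IH); first by rewrite pnatr_eq0.
move=> x; rewrite doubleS (exprS (sin x) b.+1) (exprS (sin x) b).
rewrite (mulrA (sin x)) -expr2 sin2cos2 (exprS _ s.*2.+1) (exprS _ s.*2).
rewrite -!natr1 natrD; ring.
Qed.

End RiemannMeans.

(** * Moments of linear forms on the sphere *)

Section SphereQuadrature.
Variable R : realType.

(** The double factorial (2p-1)!! *)
Definition odd_fact (p : nat) : nat := \prod_(i < p) i.*2.+1.

Lemma odd_factE p : (2 ^ p * p`! * odd_fact p = (p.*2)`!)%N.
Proof.
elim: p => [|p IH]; first by rewrite /odd_fact big_ord0.
rewrite /odd_fact big_ord_recr -/(odd_fact p) /= doubleS !factS -IH expnS.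
have -> : p.*2.+2 = (2 * p.+1)%N by rewrite mul2n doubleS.
ring.
Qed.

Lemma bin_double_odd_fact p q : (q <= p)%N ->
  ('C(p.*2, q.*2) * (odd_fact q * odd_fact (p - q)) = 'C(p, q) * odd_fact p)%N.
Proof.
move=> qp.
have pos : (0 < 2 ^ p * (q`! * (p - q)`!))%N by rewrite !muln_gt0 expn_gt0 !fact_gt0.
apply/eqP; rewrite -(eqn_pmul2l pos); apply/eqP.
have q2 : (q.*2 <= p.*2)%N by rewrite leq_double.
have e1 := bin_fact q2; have e2 := bin_fact qp.
have e3 : (p.*2 - q.*2 = (p - q).*2)%N by rewrite doubleB.
rewrite e3 -(odd_factE q) -(odd_factE (p - q)) -(odd_factE p) -e2 in e1.
have e4 : (2 ^ p = 2 ^ q * 2 ^ (p - q))%N by rewrite -expnD subnKC.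
transitivity ('C(p.*2, q.*2) *
  (2 ^ q * q`! * odd_fact q * (2 ^ (p - q) * (p - q)`! * odd_fact (p - q))))%N.
  by rewrite e4; ring.
by rewrite e1; ring.
Qed.

Definition step_prod (M p : nat) : R := \prod_(i < p) (M + i.*2)%:R.

Lemma step_prod_neq0 M p : (0 < M)%N -> step_prod M p != 0.
Proof. by move=> M0; apply/prodf_neq0 => i _; rewrite pnatr_eq0 -lt0n ltn_addr. Qed.

Lemma step_prodD M p q : step_prod M (q + p) = step_prod M q * step_prod (M + q.*2) p.
Proof.
rewrite /step_prod big_split_ord; congr (_ * _); apply: eq_bigr => i _.
by rewrite /= doubleD addnA.
Qed.

Lemma sphere_momentE M p : sphere_moment R M p = (odd_fact p)%:R / step_prod M p.
Proof.
rewrite /sphere_moment prodf_div /odd_fact natr_prod; congr (_ / _).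
Qed.

Lemma wallis_shift d q :
  wallis R (d + q.*2) = wallis R d * (step_prod d.+1 q / step_prod d.+2 q).
Proof.
elim: q => [|q IH]; first by rewrite addn0 /step_prod !big_ord0 divr1 mulr1.
rewrite doubleS !addnS wallisSS IH /step_prod !big_ord_recr /=.
rewrite !addSn; move: (d + q.*2).+1%:R (d + q.*2).+2%:R => x y.
by rewrite invfM; ring.
Qed.

(** The identity that makes the moments of a linear form depend on its norm only:
    it turns the expansion of [dotp x phi ^+ p.*2] along the first coordinate into
    the binomial expansion of the [p]-th power of the squared norm of [phi]. *)
Lemma moment_identity d p q : (q <= p)%N ->
  'C(p.*2, q.*2)%:R * (wallis R (d + q.*2) * sphere_moment R (d + q.*2).+2 (p - q))
     * sphere_moment R d.+1 q
  = 'C(p, q)%:R * wallis R d * sphere_moment R d.+2 p.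
Proof.
move=> qp; rewrite !sphere_momentE wallis_shift.
have := congr1 (fun n => n%:R : R) (bin_double_odd_fact qp).
rewrite !natrM => E.
have : step_prod d.+2 p = step_prod d.+2 q * step_prod (d + q.*2).+2 (p - q).
  by rewrite -step_prodD subnKC.
have := @step_prod_neq0 d.+1 q isT.
have := @step_prod_neq0 d.+2 q isT.
have := @step_prod_neq0 (d + q.*2).+2 (p - q) isT.
move: (step_prod d.+1 q) (step_prod d.+2 q) (step_prod (d + q.*2).+2 (p - q)).
move=> A B C C0 B0 A0 ->.
transitivity (('C(p.*2, q.*2)%:R * ((odd_fact q)%:R * (odd_fact (p - q))%:R))
   * wallis R d / (B * C)); first by field; rewrite ?A0 ?B0 ?C0.
by rewrite E; field; rewrite ?B0 ?C0.
Qed.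

Lemma dotp_scaler M (a : R) (u v : 'cV[R]_M) : dotp (a *: u) v = a * dotp u v.
Proof. by rewrite /dotp mulr_sumr; apply: eq_bigr => i _; rewrite mxE mulrA. Qed.

Lemma dotpC M (u v : 'cV[R]_M) : dotp u v = dotp v u.
Proof. by apply: eq_bigr => i _; rewrite mulrC. Qed.

Lemma dotp_col_mx M (a b : R) (u v : 'cV[R]_M) :
  dotp (col_mx a%:M u) (col_mx b%:M v) = a * b + dotp u v.
Proof.
rewrite /dotp big_split_ord /= big_ord1; congr (_ + _).
  by rewrite !col_mxEu !mxE !mulr1n.
by apply: eq_bigr => i _; rewrite !(@col_mxEd _ 1 M).
Qed.

Lemma cV_decomp M (u : 'cV[R]_M.+1) :
  exists a (v : 'cV[R]_M), u = col_mx (a%:M : 'M[R]_1) v :> 'cV[R]_(1 + M).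
Proof.
exists (usubmx (u : 'cV[R]_(1 + M)) 0 0), (dsubmx (u : 'cV[R]_(1 + M))).
by rewrite -mx11_scalar vsubmxK.
Qed.

(** Spherical coordinates: [c] and [s] stand for [cos t] and [sin t] up to sign. *)
Definition sphere_point d (c s : R) (y : 'cV[R]_d) : 'cV[R]_d.+1 :=
  col_mx (c%:M : 'M[R]_1) (s *: y) : 'cV[R]_(1 + d).

(** Riemann sums, up to a constant factor, for the uniform measure on the sphere.
    The polar angle runs over [0, pi/2] only, and the other hemisphere is reached
    by changing the sign of the first coordinate.  In dimension 1 the point -1 is
    left out: all the functions integrated below are even. *)
Fixpoint sphere_sum (n d : nat) : ('cV[R]_d.+1 -> R) -> R :=
  match d with
  | 0 => fun f => f (const_mx 1)
  | d'.+1 => fun f => quarter_mean n (fun t => sin t ^+ d' *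
      sphere_sum n (fun y => (f (sphere_point (cos t) (sin t) y)
                              + f (sphere_point (- cos t) (sin t) y)) / 2))
  end.

Lemma eq_sphere_sum n d (f g : 'cV[R]_d.+1 -> R) : f =1 g ->
  sphere_sum n f = sphere_sum n g.
Proof. by move=> /funext ->. Qed.

Lemma sphere_sum_scale n d c (f : 'cV[R]_d.+1 -> R) :
  sphere_sum n (fun x => c * f x) = c * sphere_sum n f.
Proof.
elim: d f => [//|d IH] f /=; rewrite -quarter_mean_scale.
apply: eq_quarter_mean => t; rewrite mulrCA -IH; congr (_ * _).
by apply: eq_sphere_sum => y; rewrite -mulrDr mulrA.
Qed.

Lemma sphere_sumD n d (f g : 'cV[R]_d.+1 -> R) :
  sphere_sum n (fun x => f x + g x) = sphere_sum n f + sphere_sum n g.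
Proof.
elim: d f g => [//|d IH] f g /=; rewrite -quarter_meanD.
apply: eq_quarter_mean => t; rewrite -mulrDr -IH; congr (_ * _).
by apply: eq_sphere_sum => y; rewrite -mulrDl addrACA.
Qed.

Lemma sphere_sum_sum n d m (f : 'I_m -> 'cV[R]_d.+1 -> R) :
  sphere_sum n (fun x => \sum_(i < m) f i x) = \sum_(i < m) sphere_sum n (f i).
Proof.
elim: m f => [|m IH] f.
  rewrite big_ord0 -[RHS](mul0r (sphere_sum n (fun _ : 'cV[R]_d.+1 => 0))).
  rewrite -sphere_sum_scale.
  by apply: eq_sphere_sum => x; rewrite big_ord0 mul0r.
rewrite big_ord_recr /= -IH -sphere_sumD.
by apply: eq_sphere_sum => x; rewrite big_ord_recr.
Qed.

Lemma sin_node_ge0 n (i : 'I_n.+1) : 0 <= sin (pi / 2 * (i%:R / n.+1%:R) : R).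
Proof.
have pi0 := pi_ge0 R; apply: sin_ge0_pi; apply/andP; split.
  by rewrite mulr_ge0 ?divr_ge0.
apply: (@le_trans _ _ (pi / 2)); last by lra.
by rewrite ler_piMr ?divr_ge0// ler_pdivrMr// mul1r ler_nat ltnW.
Qed.

Lemma le_sphere_sum n d (f g : 'cV[R]_d.+1 -> R) :
  (forall x, dotp x x = 1 -> f x <= g x) -> sphere_sum n f <= sphere_sum n g.
Proof.
elim: d f g => [|d IH] f g fg /=.
  by apply: fg; rewrite /dotp big_ord1 !mxE mulr1.
rewrite /quarter_mean ler_wpM2r ?invr_ge0//; apply: ler_sum => i _.
apply: ler_wpM2l; first by rewrite exprn_ge0// sin_node_ge0.
apply: IH => y y1; rewrite ler_wpM2r// lerD//; apply: fg.
  by rewrite dotp_col_mx dotp_scaler dotpC dotp_scaler y1 mulr1 -!expr2 cos2Dsin2.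
rewrite dotp_col_mx dotp_scaler dotpC dotp_scaler y1 mulr1 mulrNN -!expr2.
by rewrite cos2Dsin2.
Qed.

Lemma sum_even p (g : nat -> R) :
  \sum_(i < p.*2.+1) (if odd i then 0 else g i) = \sum_(q < p.+1) g q.*2.
Proof.
elim: p => [|p IH]; first by rewrite !big_ord1.
by rewrite doubleS 2!big_ord_recr /= IH [RHS]big_ord_recr /= odd_double /= addr0.
Qed.

Lemma even_part_exprD p (u v : R) :
  ((u + v) ^+ p.*2 + (- u + v) ^+ p.*2) / 2
  = \sum_(q < p.+1) 'C(p.*2, q.*2)%:R * u ^+ (p - q).*2 * v ^+ q.*2.
Proof.
rewrite !exprDn -big_split /= mulr_suml.
have h (q : 'I_p.+1) : (p - q).*2 = (p.*2 - q.*2)%N by rewrite doubleB.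
under [RHS]eq_bigr do rewrite h.
rewrite -(sum_even p (fun i => 'C(p.*2, i)%:R * u ^+ (p.*2 - i) * v ^+ i)).
apply: eq_bigr => i _; rewrite exprNn -signr_odd oddB ?leq_ord//.
rewrite odd_double /=; case: (odd i).
  by rewrite mulN1r mulNr mulNrn subrr mul0r.
by rewrite expr0 mul1r -mulr2n -[X in X / _ = _]mulr_natr mulfK// -mulr_natl mulrA.
Qed.

(** The odd powers of the first coordinate cancel exactly, thanks to the
    symmetrisation in [sphere_sum], before any limit is taken. *)
Lemma sphere_sum_pow_rec n d p (a : R) (v : 'cV[R]_d.+1) :
  sphere_sum n (fun x => dotp x (col_mx (a%:M : 'M[R]_1) v : 'cV[R]_(1 + d.+1)) ^+ p.*2)
  = \sum_(q < p.+1) 'C(p.*2, q.*2)%:R * a ^+ (p - q).*2 *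
      (quarter_mean n (fun t => cos t ^+ (p - q).*2 * sin t ^+ (d + q.*2))
       * sphere_sum n (fun y => dotp y v ^+ q.*2)).
Proof.
rewrite [LHS]/=.
transitivity (quarter_mean n (fun t => \sum_(q < p.+1)
  'C(p.*2, q.*2)%:R * a ^+ (p - q).*2 * sphere_sum n (fun y => dotp y v ^+ q.*2)
  * (cos t ^+ (p - q).*2 * sin t ^+ (d + q.*2)))); last first.
  rewrite quarter_mean_sum; apply: eq_bigr => q _; rewrite quarter_mean_scale.
  by rewrite mulrA mulrAC.
apply: eq_quarter_mean => t.
transitivity (sin t ^+ d * sphere_sum n (fun y => \sum_(q < p.+1)
  'C(p.*2, q.*2)%:R * (a * cos t) ^+ (p - q).*2 * sin t ^+ q.*2 * dotp y v ^+ q.*2)).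
  congr (_ * _); apply: eq_sphere_sum => y.
  rewrite !dotp_col_mx !dotp_scaler mulNr even_part_exprD.
  by apply: eq_bigr => q _; rewrite !exprMn; ring.
rewrite sphere_sum_sum mulr_sumr; apply: eq_bigr => q _.
by rewrite sphere_sum_scale exprMn exprD; ring.
Qed.

(** The limit of [sphere_sum n] at the constant function 1. *)
Definition sphere_mass d : R := \prod_(i < d) wallis R i.

Lemma sphere_mass_gt0 d : 0 < sphere_mass d.
Proof. by apply: prodr_gt0 => i _; exact: wallis_gt0. Qed.

(** Asymptotic rotation invariance, by induction on the dimension.  Applied to a
    unit vector along the first axis, it also identifies the limit with the mean
    of a power of the cosine. *)
Lemma sphere_sum_cvg d (phi : 'cV[R]_d.+1) p :
  sphere_sum n (fun x => dotp x phi ^+ p.*2) @[n --> \oo]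
    --> sphere_mass d * sphere_moment R d.+1 p * dotp phi phi ^+ p.
Proof.
elim: d phi p => [|d IH] phi p.
  rewrite /sphere_mass big_ord0 mul1r /sphere_moment.
  under eq_bigr do rewrite add1n divff ?pnatr_eq0//.
  rewrite prodr_const expr1n mul1r /= /dotp !big_ord1 !mxE mul1r -expr2.
  by rewrite -exprM mul2n; exact: cvg_cst.
have [a [v ->]] := cV_decomp phi.
rewrite (funext (fun n => sphere_sum_pow_rec n p a v)).
rewrite [X in _ --> X](_ : _ = \sum_(q < p.+1) 'C(p.*2, q.*2)%:R * a ^+ (p - q).*2 *
   ((wallis R (d + q.*2) * sphere_moment R (d + q.*2).+2 (p - q)) *
    (sphere_mass d * sphere_moment R d.+1 q * dotp v v ^+ q))).
  apply: cvg_big => [|q _]; first exact: add_continuous.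
  apply: cvgZr; apply: cvgM; first exact: cvg_quarter_mean_cos_sin.
  exact: IH.
rewrite dotp_col_mx exprDn mulr_sumr; apply: eq_bigr => q _.
have qp : (q <= p)%N by rewrite -ltnS.
rewrite -expr2 -exprM mul2n -mulr_natl.
rewrite /sphere_mass big_ord_recr /= -/(sphere_mass d).
have E := moment_identity d qp; symmetry.
transitivity (sphere_mass d * a ^+ (p - q).*2 * dotp v v ^+ q *
 ('C(p.*2, q.*2)%:R * (wallis R (d + q.*2) * sphere_moment R (d + q.*2).+2 (p - q))
     * sphere_moment R d.+1 q)); first by ring.
by rewrite E; ring.
Qed.

End SphereQuadrature.

(** * Packing double caps on the sphere *)

Section CapPacking.
Variable R : realType.

Lemma bernoulli_ineq (x : R) n : -1 <= x -> 1 + n%:R * x <= (1 + x) ^+ n.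
Proof.
move=> x1; elim: n => [|n IH]; first by rewrite mul0r addr0 expr0.
have x1' : 0 <= 1 + x by lra.
rewrite exprS; apply: le_trans (ler_wpM2l x1' IH).
have := mulr_ge0 (ler0n R n) (sqr_ge0 x).
rewrite -natr1 expr2; lra.
Qed.

Lemma le_of_small_error (a b c : R) : 0 <= c ->
  (forall e, 0 < e -> e < 1 -> a <= b + e * c) -> a <= b.
Proof.
move=> c0 H; apply/ler_addgt0Pr => d d0.
have c1 : 0 < 1 + c + d by lra.
have e0 : 0 < d / (1 + c + d) by rewrite divr_gt0.
apply: (le_trans (H (d / (1 + c + d)) e0 _)).
  by rewrite ltr_pdivrMr// mul1r; lra.
rewrite lerD2l mulrAC ler_pdivrMr// ler_wpM2l ?(ltW d0)//; lra.
Qed.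

(** The sine is concave: the mean of its derivative over [0, t] is at least that
    over [t, pi/2]. *)
Lemma jordan_sin (u : R) : 0 <= u -> u <= 1 -> u <= sin (pi / 2 * u).
Proof.
rewrite le_eqVlt => /predU1P[<-|u0]; first by rewrite mulr0 sin0.
rewrite le_eqVlt => /predU1P[->|u1]; first by rewrite mulr1 sin_pihalf.
have pi0 := pi_gt0 R; have h0 : 0 < pi / 2 :> R by lra.
set t := pi / 2 * u.
have t0 : 0 < t by rewrite mulr_gt0.
have t1 : t < pi / 2 by rewrite gtr_pMr.
have cs a b : {within `[a, b], continuous (@sin R)}.
  apply: continuous_subspaceT; exact: continuous_sin.
have [x xi Ex] := MVT t0 (fun z _ => is_derive_sin z) (@cs _ _).
have [y yi Ey] := MVT t1 (fun z _ => is_derive_sin z) (@cs _ _).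
rewrite sin0 !subr0 in Ex; rewrite sin_pihalf in Ey.
move: xi yi; rewrite !in_itv/= => /andP[x0 xt] /andP[ty yp].
have cxy : cos y <= cos x.
  by rewrite ltW// ltr_cos ?in_itv/= ?(lt_trans xt)//; apply/andP; split; lra.
have : (1 - sin t) * t <= sin t * (pi / 2 - t).
  rewrite Ey Ex [leRHS]mulrAC.
  by apply: ler_wpM2r; [exact: ltW|apply: ler_wpM2r => //; lra].
move=> H; have {H} : t <= sin t * (pi / 2) by lra.
by rewrite /t mulrC ler_pM2r.
Qed.

(** Telescope [j.+1 ^ d.+1 - j ^ d.+1 <= d.+1 * j.+1 ^ d]. *)
Lemma le_sum_expn d k : (k ^ d.+1 <= d.+1 * \sum_(i < k.+1) i ^ d)%N.
Proof.
have step m j : (j.+1 ^ m.+1 <= j ^ m.+1 + m.+1 * j.+1 ^ m)%N.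
  elim: m => [|m IH]; first by rewrite !expn1 expn0 muln1 addn1.
  rewrite expnS (leq_trans (leq_mul (leqnn j.+1) IH))// mulnDr mulSn -expnS.
  rewrite (addnC (j ^ m.+1)%N) -addnA leq_add2l mulnCA -expnS mulSn leq_add2r.
  by rewrite leq_exp2r.
elim: k => [|k IH]; first by rewrite exp0n.
rewrite big_ord_recr /= mulnDr (leq_trans (step _ _))//.
by rewrite leq_add2r.
Qed.

(** The polynomial is [1 - (1 - 'X^n) ^+ K] with [K] about [1 / (e * s' ^+ n)].
    By Bernoulli's inequality it is at most [K * u ^+ n], which is small for
    [u <= s] as [(s / s') ^+ n] is, and [(1 - u ^+ n) ^+ K] is at most
    [1 / (1 + K * u ^+ n)], hence at most [e] for [u >= s']. *)
Lemma poly_step (s s' e : R) : 0 < s -> s < s' -> s' <= 1 -> 0 < e -> e < 1 ->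
  exists P : {poly R}, [/\ forall u : R, 0 <= u <= 1 -> 0 <= P.[u] <= 1,
    forall u : R, 0 <= u <= s -> P.[u] <= e &
    forall u, s' <= u <= 1 -> 1 - e <= P.[u]].
Proof.
move=> s0 ss' s'1 e0 e1.
have s'0 : 0 < s' by apply: lt_trans ss'.
have r0 : 0 < s / s' by rewrite divr_gt0.
have r1 : s / s' < 1 by rewrite ltr_pdivrMr// mul1r.
(* This choice of [n] leaves room for rounding [K] up. *)
have [n rn] : exists n, (s / s') ^+ n * (e^-1 + 1) <= e.
  have e'0 : 0 < e / (e^-1 + 1) by rewrite divr_gt0// addr_gt0// invr_gt0.
  have := @cvg_expr R (s / s').
  rewrite (ger0_norm (ltW r0)) => /(_ r1) /cvgrPdist_le /(_ _ e'0) [n _ /(_ n (leqnn n))].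
  rewrite /= sub0r normrN ger0_norm ?exprn_ge0 ?(ltW r0)// => H.
  exists n; rewrite -ler_pdivlMr//.
  by rewrite addr_gt0// invr_gt0.
pose K := (Num.trunc (e^-1 / s' ^+ n)).+1.
have q0 : 0 < e^-1 / s' ^+ n by rewrite divr_gt0 ?invr_gt0// exprn_gt0.
have K1 : K%:R <= e^-1 / s' ^+ n + 1.
  by rewrite -natr1 lerD2r truncn_le ltW.
have K2 : e^-1 / s' ^+ n <= K%:R.
  by have /andP[_ /ltW] := truncn_itv (ltW q0).
exists (1 - (1 - 'X^n) ^+ K).
have ev (u : R) : (1 - (1 - 'X^n) ^+ K).[u] = 1 - (1 - u ^+ n) ^+ K.
  by rewrite !hornerE.
split=> u /andP[u0 u1]; rewrite ev.
- have x0 : 0 <= u ^+ n by rewrite exprn_ge0.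
  have x1 : u ^+ n <= 1 by rewrite exprn_ile1.
  have y0 : 0 <= 1 - u ^+ n by lra.
  have := exprn_ge0 K y0; have : (1 - u ^+ n) ^+ K <= 1.
    by rewrite exprn_ile1//; lra.
  by move=> h1 h2; apply/andP; split; lra.
- have us : u ^+ n <= s ^+ n by rewrite lerXn2r ?nnegrE// ltW.
  have x1 : u ^+ n <= 1.
    rewrite exprn_ile1//; lra.
  have := @bernoulli_ineq (- u ^+ n) K; rewrite lerN2 => /(_ x1) H.
  apply: (@le_trans _ _ (K%:R * u ^+ n)); first lra.
  apply: (@le_trans _ _ (K%:R * s ^+ n)); first by rewrite ler_wpM2l.
  apply: le_trans rn.
  apply: (@le_trans _ _ ((e^-1 / s' ^+ n + 1) * s ^+ n)).
    by rewrite ler_wpM2r// exprn_ge0// ltW.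
  rewrite !mulrDr mulrDl mulr1 mul1r expr_div_n; apply: lerD.
    by rewrite le_eqVlt mulrC mulrA mulrAC eqxx.
  by rewrite ler_peMr ?exprn_ge0 ?(ltW s0)// invf_ge1 ?exprn_gt0// exprn_ile1// ltW.
- have u'0 : 0 <= u by apply: le_trans u0; exact: ltW.
  have x0 : 0 <= u ^+ n by rewrite exprn_ge0.
  have x1 : u ^+ n <= 1 by rewrite exprn_ile1.
  have us : s' ^+ n <= u ^+ n by rewrite lerXn2r ?nnegrE// ltW.
  have B : e^-1 <= (1 + u ^+ n) ^+ K.
    apply: le_trans (bernoulli_ineq K _); last lra.
    apply: (@le_trans _ _ (K%:R * u ^+ n)); last lra.
    apply: (@le_trans _ _ (K%:R * s' ^+ n)); last by rewrite ler_wpM2l.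
    by rewrite -ler_pdivrMr ?exprn_gt0.
  rewrite lerD2l lerN2.
  have p1 : (1 - u ^+ n) ^+ K * (1 + u ^+ n) ^+ K <= 1.
    rewrite -exprMn exprn_ile1//.
      by rewrite mulr_ge0//; lra.
    have := sqr_ge0 (u ^+ n); rewrite expr2; lra.
  have b0 : 0 < (1 + u ^+ n) ^+ K by rewrite exprn_gt0//; lra.
  have : (1 - u ^+ n) ^+ K <= ((1 + u ^+ n) ^+ K)^-1.
    by rewrite -[_^-1]mul1r ler_pdivlMr.
  move=> /le_trans; apply; rewrite -[e]invrK lef_pV2 ?posrE// invr_gt0//.
Qed.

(** Jordan's inequality bounds the sine
    at the [i]-th node below by [i / n.+1], and a sum of [d]-th powers of consecutive
    integers is at least the corresponding integral. *)
Lemma quarter_mean_cap_ge d (rho c : R) (g : R -> R) l :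
  0 < rho -> rho < 1 -> 0 <= c ->
  (forall t, 0 <= t <= pi / 2 -> 0 <= g t) ->
  (forall t, 0 <= t <= pi / 2 * rho -> c <= g t) ->
  quarter_mean n (fun t => g t * sin t ^+ d) @[n --> \oo] --> l ->
  c * (rho ^+ d.+1 / d.+1%:R) <= l.
Proof.
move=> rho0 rho1 c0 g0 gc gl.
have pi0 := pi_gt0 R; have h0 : 0 < pi / 2 :> R by lra.
have low : c * ((rho - n.+1%:R^-1) ^+ d.+1 / d.+1%:R) @[n --> \oo]
    --> c * (rho ^+ d.+1 / d.+1%:R).
  apply: cvgZr; apply: cvgZl.
  have cr : rho - n.+1%:R^-1 @[n --> \oo] --> rho.
    rewrite -[X in _ --> X]subr0; apply: cvgB; first exact: cvg_cst.
    exact: cvg_harmonic.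
  exact: (cvg_comp (fun n : nat => rho - n.+1%:R^-1) (fun x : R => x ^+ d.+1)
    cr (@exprn_continuous _ _ _)).
apply: (ler_cvg_to low gl); near=> n.
have m0 : 0 < n.+1%:R :> R by [].
pose m : R := n.+1%:R.
(* The cap contains the nodes numbered from 0 to [k]. *)
pose k := Num.trunc (rho * m).
have rm0 : 0 <= rho * m by rewrite mulr_ge0 ?ltW.
have [k1 k2] : k%:R <= rho * m /\ rho * m < k.+1%:R.
  by have /andP[] := truncn_itv rm0.
have kn : (k.+1 <= n.+1)%N.
  by rewrite -(ltr_nat R) (le_lt_trans k1)// gtr_pMl.
have node_le (i : nat) : (i <= k)%N -> i%:R / m <= rho.
  move=> ik; rewrite ler_pdivrMr//; apply: le_trans k1; by rewrite ler_nat.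
have dropterm (i : nat) : (i <= n)%N ->
    0 <= g (pi / 2 * (i%:R / m)) * sin (pi / 2 * (i%:R / m)) ^+ d.
  move=> iN; have u0 : 0 <= i%:R / m by rewrite divr_ge0.
  have u1 : i%:R / m <= 1 by rewrite ler_pdivrMr// mul1r ler_nat ltnW.
  rewrite mulr_ge0//.
    by apply: g0; rewrite mulr_ge0 ?(ltW h0)//= ler_piMr// ltW.
  rewrite exprn_ge0//; exact: le_trans (jordan_sin u0 u1).
have keepterm (i : nat) : (i <= k)%N ->
    c * (i%:R / m) ^+ d <= g (pi / 2 * (i%:R / m)) * sin (pi / 2 * (i%:R / m)) ^+ d.
  move=> ik; have u0 : 0 <= i%:R / m by rewrite divr_ge0.
  have u1 : i%:R / m <= 1 by apply: le_trans (node_le _ ik) _; exact: ltW.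
  apply: ler_pM => //; first by rewrite exprn_ge0.
    by apply: gc; rewrite mulr_ge0 ?(ltW h0)//= ler_pM2l// node_le.
  have s0 := jordan_sin u0 u1.
  by rewrite lerXn2r ?nnegrE// (le_trans u0).
apply: (@le_trans _ _ ((\sum_(i < k.+1) c * (i%:R / m) ^+ d) / m)).
  have -> : (\sum_(i < k.+1) c * (i%:R / m) ^+ d) / m =
      c * ((\sum_(i < k.+1) i ^ d)%N%:R / m ^+ d.+1).
    rewrite -mulr_sumr -mulrA; congr (_ * _).
    rewrite natr_sum exprS invfM (mulrC m^-1) mulrA; congr (_ * _).
    by rewrite mulr_suml; apply: eq_bigr => i _; rewrite expr_div_n natrX.
  apply: ler_wpM2l => //.
  have P : (k%:R / m) ^+ d.+1 / d.+1%:R <= (\sum_(i < k.+1) i ^ d)%N%:R / m ^+ d.+1.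
    rewrite expr_div_n mulrAC ler_pM2r ?invr_gt0 ?exprn_gt0//.
    by rewrite ler_pdivrMr// -natrX -natrM ler_nat mulnC le_sum_expn.
  apply: le_trans P; rewrite ler_pM2r ?invr_gt0//.
  have low0 : 0 <= rho - n.+1%:R^-1.
    rewrite subr_ge0 -[rho]invrK lef_pV2 ?posrE ?invr_gt0//.
    apply: (@le_trans _ _ n%:R); last by rewrite ler_nat.
    near: n; exact: nbhs_infty_ger.
  have k0 : 0 <= k%:R / m by rewrite divr_ge0.
  rewrite ler_pXn2r ?nnegrE// ler_pdivlMr// mulrBl mulVf ?gt_eqF//.
  by rewrite lerBlDr natr1 ltW.
rewrite /quarter_mean -/m ler_pM2r ?invr_gt0//.
rewrite -(big_mkord xpredT (fun i => c * (i%:R / m) ^+ d)).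
rewrite -(big_mkord xpredT
  (fun i => g (pi / 2 * (i%:R / m)) * sin (pi / 2 * (i%:R / m)) ^+ d)).
rewrite [leRHS](big_cat_nat (n := k.+1))//= -[leLHS]addr0; apply: lerD.
  rewrite big_nat_cond [leRHS]big_nat_cond; apply: ler_sum => i.
  by rewrite andbT ltnS => /andP[_]; exact: keepterm.
rewrite big_nat_cond; apply: sumr_ge0 => i.
by rewrite andbT ltnS => /andP[_]; exact: dropterm.
Unshelve. all: by end_near. Qed.

(** The mean of [P.[x_0 ^+ 2]] for [x] uniform on the unit sphere in dimension
    [M]. *)
Definition sphere_poly_mean M (P : {poly R}) : R :=
  \sum_(i < size P) P`_i * sphere_moment R M i.

Lemma cvg_quarter_mean_poly d (P : {poly R}) :
  quarter_mean n (fun t => P.[cos t ^+ 2] * sin t ^+ d) @[n --> \oo]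
    --> wallis R d * sphere_poly_mean d.+2 P.
Proof.
have E n : quarter_mean n (fun t : R => P.[cos t ^+ 2] * sin t ^+ d) =
  \sum_(i < size P) P`_i * quarter_mean n (fun t : R => cos t ^+ i.*2 * sin t ^+ d).
  transitivity (quarter_mean n (fun t : R => \sum_(i < size P)
      P`_i * (cos t ^+ i.*2 * sin t ^+ d))).
    apply: eq_quarter_mean => t; rewrite horner_coef mulr_suml.
    by apply: eq_bigr => i _; rewrite -exprM mul2n mulrA.
  by rewrite quarter_mean_sum; apply: eq_bigr => i _; rewrite quarter_mean_scale.
rewrite (funext E) /sphere_poly_mean mulr_sumr.
apply: cvg_big => [|i _]; first exact: add_continuous.
rewrite mulrCA; apply: cvgZr; exact: cvg_quarter_mean_cos_sin.
Qed.

Lemma cvg_sphere_sum_poly d (P : {poly R}) (phi : 'cV[R]_d.+1) : dotp phi phi = 1 ->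
  sphere_sum n (fun x => P.[dotp x phi ^+ 2]) @[n --> \oo]
    --> sphere_mass R d * sphere_poly_mean d.+1 P.
Proof.
move=> phi1.
have E n : sphere_sum n (fun x => P.[dotp x phi ^+ 2]) =
  \sum_(i < size P) P`_i * sphere_sum n (fun x => dotp x phi ^+ i.*2).
  transitivity (sphere_sum n (fun x => \sum_(i < size P) P`_i * dotp x phi ^+ i.*2)).
    apply: eq_sphere_sum => x; rewrite horner_coef.
    by apply: eq_bigr => i _; rewrite -exprM mul2n.
  by rewrite sphere_sum_sum; apply: eq_bigr => i _; rewrite sphere_sum_scale.
rewrite (funext E) /sphere_poly_mean mulr_sumr.
apply: cvg_big => [|i _]; first exact: add_continuous.
rewrite mulrCA; apply: cvgZr.
by have := @sphere_sum_cvg _ _ phi i; rewrite phi1 expr1n mulr1.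
Qed.

Lemma dotpDl M (u v w : 'cV[R]_M) : dotp (u + v) w = dotp u w + dotp v w.
Proof.
by rewrite /dotp -big_split; apply: eq_bigr => k _; rewrite mxE mulrDl.
Qed.

Lemma dotp_ge0 M (u : 'cV[R]_M) : 0 <= dotp u u.
Proof. by apply: sumr_ge0 => k _; rewrite -expr2 sqr_ge0. Qed.

Lemma dotp_norm_le M (u v : 'cV[R]_M) : `|dotp u v| *+ 2 <= dotp u u + dotp v v.
Proof.
have h (a : R) : a * a = 1 -> 0 <= dotp u u + dotp v v + a * dotp u v *+ 2.
  move=> a1; have := dotp_ge0 (u + a *: v).
  rewrite dotpDl dotp_scaler (dotpC u) (dotpC v) !dotpDl !dotp_scaler.
  rewrite (dotpC v u) mulrDr mulrA a1 mul1r mulr2n; lra.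
have := h 1 (mulr1 1); have := h (-1) (etrans (mulrNN 1 1) (mulr1 1)).
rewrite mulN1r mul1r !mulr2n.
by case: (ger0P (dotp u v)) => _; lra.
Qed.

Lemma dotp_unit_le1 M (u v : 'cV[R]_M) : dotp u u = 1 -> dotp v v = 1 ->
  `|dotp u v| <= 1.
Proof. by move=> u1 v1; have := dotp_norm_le u v; rewrite u1 v1 mulr2n; lra. Qed.

(** With [s = cos^2 r] this is the triangle inequality for angles: two lines at
    angle less than [r] from the line of [x] are at an angle less than [2r].
    The components of [u] and [v] orthogonal to [x] have squared norms less than
    [1 - s], so their inner product is less than [1 - s]. *)
Lemma caps_disjoint M (x u v : 'cV[R]_M) s :
  dotp x x = 1 -> dotp u u = 1 -> dotp v v = 1 -> 0 <= s ->
  s < dotp x u ^+ 2 -> s < dotp x v ^+ 2 -> 2 * s - 1 < `|dotp u v|.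
Proof.
move=> x1 u1 v1 s0; set a := dotp x u; set b := dotp x v => ua vb.
have := dotp_norm_le (u - a *: x) (v - b *: x).
have E (w z : 'cV[R]_M) (c e : R) : dotp x w = c -> dotp x z = e ->
    dotp (w - c *: x) (z - e *: x) = dotp w z - c * e.
  move=> wc ze; rewrite -!scaleNr dotpDl dotp_scaler (dotpC w) (dotpC x).
  rewrite !dotpDl !dotp_scaler x1 wc (dotpC z x) ze (dotpC z w).
  by rewrite /GRing.scale /=; ring.
rewrite !E// u1 v1 -!expr2 => H.
have H1 : `|dotp u v - a * b| < 1 - s by move: H; rewrite mulr2n; lra.
have ab : s < `|a * b|.
  rewrite -(ltr_pXn2r (n := 2)) ?nnegrE// -normrX ger0_norm ?sqr_ge0//.
  by rewrite exprMn expr2; apply: ltr_pM.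
have : `|a * b| <= `|dotp u v| + `|dotp u v - a * b|.
  have -> : a * b = dotp u v - (dotp u v - a * b) by ring.
  by rewrite (le_trans (ler_normB _ _))// opprB addrCA subrr addr0.
lra.
Qed.

Section Packing.
Variables (d N : nat) (phi : 'I_N -> 'cV[R]_d.+2) (mu : R).
Hypothesis phi1 : forall i, dotp (phi i) (phi i) = 1.
Hypothesis phi_mu : forall i j, i != j -> `|dotp (phi i) (phi j)| <= mu.
Hypothesis mu01 : 0 <= mu < 1.

(** At most one double cap contains [x]; the other summands are at most [e]. *)
Lemma sum_caps_le (P : {poly R}) (e : R) x : 0 <= e -> dotp x x = 1 ->
  (forall u : R, 0 <= u <= 1 -> 0 <= P.[u] <= 1) ->
  (forall u : R, 0 <= u <= (1 + mu) / 2 -> P.[u] <= e) ->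
  \sum_(i < N) P.[dotp x (phi i) ^+ 2] <= 1 + N%:R * e.
Proof.
move=> e0 x1 P01 Pe; have /andP[m0 m1] := mu01.
have sq01 i : 0 <= dotp x (phi i) ^+ 2 <= 1.
  by rewrite sqr_ge0 -real_normK ?num_real//= exprn_ile1// dotp_unit_le1.
have small i : dotp x (phi i) ^+ 2 <= (1 + mu) / 2 -> P.[dotp x (phi i) ^+ 2] <= e.
  by move=> h; apply: Pe; rewrite h andbT; have /andP[] := sq01 i.
have [i0 Hi0|none] := pickP (fun i => (1 + mu) / 2 < dotp x (phi i) ^+ 2).
- rewrite (bigD1 i0)//=; apply: lerD; first by have /andP[] := P01 _ (sq01 i0).
  apply: (@le_trans _ _ (\sum_(i < N | i != i0) e)).
    apply: ler_sum => i ii0; apply: small; rewrite leNgt; apply/negP => Hi.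
    have s0 : 0 <= (1 + mu) / 2 by lra.
    have := caps_disjoint x1 (phi1 i) (phi1 i0) s0 Hi Hi0.
    by have := phi_mu ii0; lra.
  apply: (@le_trans _ _ (\sum_(i < N) e)); last by rewrite sumr_const card_ord mulr_natl.
  by rewrite [leRHS](bigD1 i0)//= lerDr.
- apply: (@le_trans _ _ (\sum_(i < N) e)).
    by apply: ler_sum => i _; apply: small; rewrite leNgt none.
  by rewrite sumr_const card_ord mulr_natl lerDr.
Qed.

(** By positivity the pointwise bound [sum_caps_le] may be summed over the nodes
    of the quadrature, and each of the [N] columns contributes the same limit. *)
Lemma poly_packing (P : {poly R}) (e : R) : 0 <= e ->
  (forall u : R, 0 <= u <= 1 -> 0 <= P.[u] <= 1) ->
  (forall u : R, 0 <= u <= (1 + mu) / 2 -> P.[u] <= e) ->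
  N%:R * sphere_poly_mean d.+2 P <= 1 + N%:R * e.
Proof.
move=> e0 P01 Pe; rewrite -(ler_pM2l (sphere_mass_gt0 R d.+1)).
have c1 : sphere_sum n (fun x => \sum_(i < N) P.[dotp x (phi i) ^+ 2]) @[n --> \oo]
   --> sphere_mass R d.+1 * (N%:R * sphere_poly_mean d.+2 P).
  rewrite (funext (fun n => sphere_sum_sum n (fun i x => P.[dotp x (phi i) ^+ 2]))).
  rewrite mulrCA mulr_natl -[X in _ *+ X]card_ord -sumr_const.
  apply: cvg_big => [|i _]; first exact: add_continuous.
  exact: cvg_sphere_sum_poly.
have c2 : sphere_sum n (fun _ : 'cV[R]_d.+2 => 1 + N%:R * e) @[n --> \oo]
   --> sphere_mass R d.+1 * (1 + N%:R * e).
  have E n : sphere_sum n (fun _ : 'cV[R]_d.+2 => 1 + N%:R * e) =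
    (1 + N%:R * e) * sphere_sum n (fun x : 'cV[R]_d.+2 => dotp x 0 ^+ 0.*2).
    rewrite -sphere_sum_scale; apply: eq_sphere_sum => x.
    by rewrite expr0 mulr1.
  rewrite (funext E) [sphere_mass R _ * _]mulrC; apply: cvgZr.
  have := @sphere_sum_cvg _ _ (0 : 'cV[R]_d.+2) 0.
  by rewrite expr0 /sphere_moment big_ord0 !mulr1.
apply: (ler_cvg_to c1 c2); near=> n.
by apply: le_sphere_sum => x x1; apply: sum_caps_le.
Unshelve. all: by end_near. Qed.

(** The angle [pi / 2 * rho] is kept strictly below half of [acos mu] to leave
    room for the polynomial to climb from [e] to [1 - e]. *)
Lemma cap_packing_lt (rho : R) : 0 < rho -> rho < acos mu / pi ->
  N%:R * (rho ^+ d.+1 / d.+1%:R) <= wallis R d.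
Proof.
move=> rho0 rhoa; have /andP[m0 m1] := mu01; have pi0 := pi_gt0 R.
have mI : -1 <= mu <= 1 by apply/andP; split; lra.
have am : acos mu <= pi / 2.
  rewrite leNgt; apply/negP => h; have := acosK (_ : mu \in `[-1, 1]).
  rewrite in_itv/= mI => /(_ isT) E.
  have : cos (acos mu) < cos (pi / 2).
    rewrite ltr_cos// ?in_itv/=; apply/andP; split; try lra.
    exact: acos_lepi.
  by rewrite cos_pihalf E; lra.
have rho1 : rho < 1.
  by apply: (lt_le_trans rhoa); rewrite ler_pdivrMr// mul1r; lra.
have rp : pi / 2 * rho < acos mu / 2.
  by move: rhoa; rewrite ltr_pdivlMr//; lra.
have rp0 : 0 < pi / 2 * rho by rewrite mulr_gt0//; lra.
have cosI (t : R) : 0 <= t <= pi / 2 -> 0 <= cos t.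
  by move=> /andP[t0 t1]; apply: cos_ge0_pihalf; apply/andP; split; lra.
have sE : (1 + mu) / 2 = cos (acos mu / 2) ^+ 2.
  have := cos_mulr2n (acos mu / 2); rewrite mulr2n -splitr acosK ?in_itv//=.
  by rewrite mulr2n => E; lra.
have cmono (t u : R) : 0 <= t -> t < u -> u <= pi / 2 -> cos u ^+ 2 < cos t ^+ 2.
  move=> t0 tu u1; rewrite ltr_pXn2r ?nnegrE ?cosI//; try by apply/andP; split; lra.
  by rewrite ltr_cos ?in_itv/=//; apply/andP; split; lra.
have ss' : (1 + mu) / 2 < cos (pi / 2 * rho) ^+ 2.
  by rewrite sE; apply: cmono; lra.
have s'1 : cos (pi / 2 * rho) ^+ 2 <= 1.
  by rewrite -real_normK ?num_real// exprn_ile1// cos_max.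
pose A := rho ^+ d.+1 / d.+1%:R.
have A0 : 0 <= A by rewrite divr_ge0// exprn_ge0// ltW.
have w0 := ltW (wallis_gt0 R d).
apply: (@le_of_small_error _ _ (wallis R d * N%:R + N%:R * A)).
  by rewrite addr_ge0// mulr_ge0.
move=> e e0 e1; rewrite -/A.
have s0 : 0 < (1 + mu) / 2 by lra.
have [P [P01 Pe P1]] := poly_step s0 ss' s'1 e0 e1.
have H1 := poly_packing (ltW e0) P01 Pe.
have H2 : (1 - e) * A <= wallis R d * sphere_poly_mean d.+2 P.
  apply: (@quarter_mean_cap_ge d rho (1 - e) (fun t => P.[cos t ^+ 2]) _
    rho0 rho1 _ _ _ (@cvg_quarter_mean_poly d P)).
  - lra.
  - move=> t _; have c1 : 0 <= cos t ^+ 2 <= 1.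
      by rewrite sqr_ge0 -real_normK ?num_real//= exprn_ile1// cos_max.
    by have /andP[] := P01 _ c1.
  - move=> t /andP[t0]; rewrite le_eqVlt => tr; apply: P1; apply/andP; split.
      case/predU1P: tr => [->//|tr].
      by apply/ltW/cmono => //; lra.
    by rewrite -real_normK ?num_real// exprn_ile1// cos_max.
have H3 := ler_wpM2l (ler0n R N) H2.
have H4 := ler_wpM2l w0 H1.
by rewrite -/A in H3 *; lra.
Qed.

Lemma cap_packing : N%:R * ((acos mu / pi) ^+ d.+1 / d.+1%:R) <= wallis R d.
Proof.
have /andP[m0 m1] := mu01; have pi0 := pi_gt0 R.
set rho := acos mu / pi.
have rho0 : 0 < rho.
  by rewrite divr_gt0// acos_gt0//; apply/andP; split; lra.
set A := rho ^+ d.+1 / d.+1%:R.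
have A0 : 0 <= A by rewrite divr_ge0// exprn_ge0// ltW.
apply: (@le_of_small_error _ _ (d.+1%:R * (N%:R * A))).
  by rewrite mulr_ge0// mulr_ge0.
move=> e e0 e1.
have r0 : 0 < rho * (1 - e) by rewrite mulr_gt0//; lra.
have rr : rho * (1 - e) < rho by rewrite gtr_pMr//; lra.
have := cap_packing_lt r0 rr; rewrite exprMn mulrAC -/A => H.
have e1' : -1 <= - e by lra.
have B := bernoulli_ineq d.+1 e1'.
have NA : 0 <= N%:R * A by rewrite mulr_ge0.
have := ler_wpM2l NA B; rewrite -(mulrA N%:R A) in H *; lra.
Qed.

End Packing.
End CapPacking.

(** * The Gamma function at half-integers *)

Section GammaHalfIntegers.
Variable R : realType.
Notation mu := (@lebesgue_measure R).

(** The recurrence of Gamma and its value at 1/2 are first proved on compact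
    intervals away from 0, where the integrands are smooth.  The limit is then
    taken in the extended reals, so that no integrability has to be known
    beforehand. *)
Lemma cvg_integral_exhaust (a b : nat -> R) (f : R -> R) :
  (forall n, 0 < a n) -> {homo a : m n / (m <= n)%N >-> n <= m} ->
  {homo b : m n / (m <= n)%N >-> m <= n} ->
  (forall x, 0 < x -> exists n, a n <= x <= b n) ->
  measurable_fun (`]0, +oo[ : set R) f -> (forall x, 0 < x -> 0 <= f x) ->
  (\int[mu]_(x in `[a n, b n]) (f x)%:E)%E @[n --> \oo]
    --> (\int[mu]_(x in `]0%R, +oo[) (f x)%:E)%E.
Proof.
move=> a0 ah bh ab mf f0.
have E : \bigcup_n `[a n, b n]%classic = `]0, +oo[%classic.
  apply/seteqP; split => [x [n _]|x]/=.
    by rewrite !in_itv/= andbT => /andP[/(lt_le_trans (a0 n))].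
  rewrite in_itv/= andbT => /ab[n xn]; exists n => //.
rewrite -E; apply: ge0_nondecreasing_set_cvg_integral.
- move=> m n mn; rewrite subsetEset => x /=; rewrite !in_itv/= => /andP[x1 x2].
  by rewrite (le_trans (ah _ _ mn) x1) (le_trans x2 (bh _ _ mn)).
- by move=> n; exact: measurable_itv.
- move=> n; apply/measurable_EFinP; apply: measurable_funS mf => //.
  by rewrite -E => x xn; exists n.
- move=> n x /=; rewrite in_itv/= => /andP[x1 _].
  by rewrite lee_fin f0// (lt_le_trans (a0 n)).
Qed.

Let inv_homo : {homo (fun n => n.+1%:R^-1 : R) : m n / (m <= n)%N >-> n <= m}.
Proof. by move=> m n mn; rewrite lef_pV2 ?posrE// ler_nat. Qed.

Let nat_homo : {homo (fun n => n.+1%:R : R) : m n / (m <= n)%N >-> m <= n}.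
Proof. by move=> m n mn; rewrite ler_nat. Qed.

Let exhaust (x : R) : 0 < x -> exists n : nat, n.+1%:R^-1 <= x <= n.+1%:R.
Proof.
move=> x0; exists (Num.trunc (Num.max x x^-1)).
have m0 : 0 <= Num.max x x^-1 by rewrite le_max ltW.
have /andP[_ /ltW] := truncn_itv m0; rewrite ge_max => /andP[xn xV].
by rewrite xn andbT -[leRHS]invrK lef_pV2 ?posrE ?invr_gt0// xV.
Qed.

Definition gamma_integrand (s t : R) : R := t `^ (s - 1) * expR (- t).

Lemma continuous_expRN : continuous (fun t : R => expR (- t)).
Proof.
move=> t; apply: (@continuous_comp _ _ _ -%R expR); last exact: continuous_expR.
exact: opp_continuous.
Qed.

Lemma measurable_gamma_integrand (s : R) :
  measurable_fun (`]0, +oo[ : set R) (gamma_integrand s).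
Proof.
apply: measurable_funM.
  by apply: measurable_funTS; exact: measurable_powR.
apply: measurable_funTS; apply: continuous_measurable_fun.
exact: continuous_expRN.
Qed.

Lemma gamma_integrand_ge0 (s t : R) : 0 <= gamma_integrand s t.
Proof. by rewrite mulr_ge0 ?powR_ge0 ?expR_ge0. Qed.

Lemma integral_gamma_parts (s a b : R) : 0 <= s -> 0 < a -> a <= b ->
  (\int[mu]_(t in `[a, b]) (gamma_integrand (s + 1) t)%:E =
   (a `^ s * expR (- a) - b `^ s * expR (- b))%:E +
   \int[mu]_(t in `[a, b]) (s * gamma_integrand s t)%:E)%E.
Proof.
move=> s0 a0; rewrite le_eqVlt => /predU1P[<-|ab].
  by rewrite set_itv1 !integral_set1 subrr adde0.
have pos x : x \in `]a, b[ -> 0 < x.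
  by rewrite in_itv/= => /andP[/(lt_trans a0)].
have posc x : x \in `[a, b] -> 0 < x.
  by rewrite in_itv/= => /andP[/(lt_le_trans a0)].
have dN (x : R) : is_derive x 1 (fun t => - expR (- t)) (expR (- x)).
  by apply: is_derive_eq; rewrite /GRing.scale/= mulrN1 opprK.
have dP (x : R) : 0 < x -> is_derive x 1 (fun t : R => t `^ s) (s * x `^ (s - 1)).
  exact: is_derive1_powR.
have lr (h : R -> R) : (forall x, 0 < x -> derivable h x 1) ->
    derivable_oo_LRcontinuous h a b.
  move=> dh; have ch x : 0 < x -> {for x, continuous h}.
    by move=> /dh /derivable1_diffP /differentiable_continuous.
  split; first by move=> x /pos /dh.
    by apply: cvg_at_right_filter; exact: ch.
  by apply: cvg_at_left_filter; apply: ch; exact: lt_trans ab.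
have := @integration_by_parts R (fun t => t `^ s) (fun t => - expR (- t))
  (fun t => s * t `^ (s - 1)) (fun t => expR (- t)) a b ab.
rewrite /gamma_integrand addrK => ->.
- have -> : (\int[mu]_(x in `[a, b]) (s * x `^ (s - 1) * - expR (- x))%:E
      = - \int[mu]_(x in `[a, b]) (s * (x `^ (s - 1) * expR (- x)))%:E)%E.
    rewrite -integral_ge0N; last first.
      by move=> x _; rewrite lee_fin !mulr_ge0 ?powR_ge0 ?expR_ge0.
    by apply: eq_integral => x _; rewrite -EFinN mulrN mulrA.
  by rewrite oppeK; congr (_%:E + _)%E; rewrite !mulrN opprK addrC.
- apply: derivable_within_continuous => x /posc x0; apply: ex_derive.
  by apply: is_derive_eq; first exact: (is_deriveZ _ (is_derive1_powR (s - 1) x0)).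
- by apply: lr => x /dP dx; exact: ex_derive.
- by move=> x /pos x0; rewrite derive1E; have /@derive_val -> := dP x x0.
- exact: continuous_subspaceT continuous_expRN.
- by apply: lr => x _; exact: ex_derive.
- by move=> x _; rewrite derive1E; have /@derive_val -> := dN x.
Qed.

Lemma cvg_powR_expRN (s : R) : n.+1%:R `^ s * expR (- n.+1%:R) @[n --> \oo] --> (0 : R).
Proof.
pose k := (Num.trunc `|s|).+1.
have sk : s <= k%:R.
  have /andP[_ /ltW] := truncn_itv (normr_ge0 s); apply: le_trans.
  exact: ler_norm.
apply: (@squeeze_cvgr _ _ _ _ (fun=> 0) (fun n => k.+1`!%:R * n.+1%:R^-1)).
- near=> n; rewrite mulr_ge0 ?powR_ge0 ?expR_ge0//=.
  have n0 : 0 < n.+1%:R :> R by [].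
  have n1 : 1 <= n.+1%:R :> R by rewrite ler1n.
  rewrite expRN ler_pdivrMr ?expR_gt0//.
  apply: (@le_trans _ _ (n.+1%:R ^+ k)).
    by rewrite -powR_mulrn// ler_powR.
  have := expR_ge1Dxn k (ltW n0).
  have f0 : 0 < k.+1`!%:R :> R by rewrite ltr0n fact_gt0.
  move=> H; rewrite mulrAC ler_pdivlMr// -exprSr -ler_pdivrMl// mulrC.
  by apply: le_trans H; rewrite lerDr.
- exact: cvg_cst.
- rewrite -[X in _ --> X](mulr0 k.+1`!%:R); apply: cvgZr; exact: cvg_harmonic.
Unshelve. all: by end_near. Qed.

Lemma cvg_powR_harmonic (s : R) : 0 < s -> (n.+1%:R^-1) `^ s @[n --> \oo] --> (0 : R).
Proof.
move=> s0; have /cvg_at_rightP := powR_cvg0 s0.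
move=> /(_ (fun n => n.+1%:R^-1)); apply; split => //.
exact: cvg_harmonic.
Qed.

Lemma GammaS (s : R) : 0 < s -> Gamma (s + 1) = s * Gamma s.
Proof.
move=> s0; have s0' := ltW s0.
have mg : measurable_fun (`]0, +oo[ : set R) (fun t => s * gamma_integrand s t).
  apply: measurable_funM; first exact: measurable_cst.
  exact: measurable_gamma_integrand.
have sg0 x : 0 < x -> 0 <= s * gamma_integrand s x.
  by move=> _; rewrite mulr_ge0// gamma_integrand_ge0.
have ip n : 0 < n.+1%:R^-1 :> R by rewrite invr_gt0.
have c1 := cvg_integral_exhaust ip inv_homo nat_homo exhaust
  (measurable_gamma_integrand (s + 1)) (fun x _ => gamma_integrand_ge0 (s + 1) x).
have c2 := cvg_integral_exhaust ip inv_homo nat_homo exhaust mg sg0.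
have bd : (n.+1%:R^-1 `^ s * expR (- n.+1%:R^-1) - n.+1%:R `^ s * expR (- n.+1%:R))%:E
    @[n --> \oo] --> (0%:E : \bar R).
  apply: cvg_EFin; first by near=> n.
  rewrite /comp/= -[X in _ --> X](subr0 0).
  apply: cvgB; last exact: cvg_powR_expRN.
  apply: (@squeeze_cvgr _ _ _ _ (fun=> 0) (fun n => n.+1%:R^-1 `^ s)).
  - by near=> n; rewrite mulr_ge0 ?powR_ge0 ?expR_ge0//= ler_piMr ?powR_ge0//.
  - exact: cvg_cst.
  - exact: cvg_powR_harmonic.
have E : (\int[mu]_(t in `]0%R, +oo[) (gamma_integrand (s + 1) t)%:E =
     s%:E * \int[mu]_(t in `]0%R, +oo[) (gamma_integrand s t)%:E)%E.
  rewrite -ge0_integralZl_EFin//; last 2 first.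
    by move=> x _; rewrite lee_fin gamma_integrand_ge0.
    by apply/measurable_EFinP; exact: measurable_gamma_integrand.
  under [RHS]eq_integral do rewrite -EFinM.
  have c3 := cvgeD (@fin_num_adde_defr R 0%:E _ isT) bd c2; rewrite add0e in c3.
  apply: (cvg_unique (@ereal_hausdorff R) c1) => /=.
  have -> : (fun n : nat => \int[mu]_(t in `[n.+1%:R^-1%R, n.+1%:R])
      (gamma_integrand (s + 1) t)%:E)%E = (fun n : nat =>
      (n.+1%:R^-1 `^ s * expR (- n.+1%:R^-1) - n.+1%:R `^ s * expR (- n.+1%:R))%:E
      + \int[mu]_(t in `[n.+1%:R^-1%R, n.+1%:R]) (s * gamma_integrand s t)%:E)%E.
    apply/funext => n; apply: integral_gamma_parts => //.
    by apply: (@le_trans _ _ 1); [rewrite invf_le1// ler1n|rewrite ler1n].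
  exact: c3.
rewrite /Gamma /Rintegral -/(gamma_integrand (s + 1)) [X in fine X]E.
(* An infinite integral would be read as 0 on both sides. *)
have : (0 <= \int[mu]_(t in `]0%R, +oo[) (gamma_integrand s t)%:E)%E.
  by apply: integral_ge0 => x _; rewrite lee_fin gamma_integrand_ge0.
case: (\int[mu]_(t in _) _)%E => [r|_|//]; first by [].
by rewrite gt0_muley ?lte_fin// mulr0.
Unshelve. all: by end_near. Qed.

Lemma Gamma1 : Gamma 1 = 1 :> R.
Proof.
rewrite /Gamma (@eq_Rintegral _ _ R mu _ (fun t : R => expR (- t))); last first.
  by move=> x _; rewrite subrr powRr0 mul1r.
rewrite /Rintegral integral_itv_obnd_cbnd; last first.
  apply/measurable_EFinP/measurable_funTS.
  by apply: continuous_measurable_fun; exact: continuous_expRN.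
have dN (x : R) : is_derive x 1 (fun t => - expR (- t)) (expR (- x)).
  by apply: is_derive_eq; rewrite /GRing.scale/= mulrN1 opprK.
rewrite (@ge0_continuous_FTC2y _ _ (fun t => - expR (- t)) 0 (- 0)).
- by rewrite -EFinB /= oppr0 expR0 opprK add0r.
- by move=> x _; exact: expR_ge0.
- exact: continuous_subspaceT continuous_expRN.
- by apply: cvgN; exact: cvgr_expR.
- by move=> x _; exact: ex_derive.
- apply: cvg_at_right_filter; apply: cvgN; exact: continuous_expRN.
- by move=> x _; rewrite derive1E; have /@derive_val -> := dN x.
Qed.

(** The substitution [t = x ^+ 2] leads to the Gauss integral. *)
Lemma Gamma_half : Gamma (1 / 2) = Num.sqrt pi :> R.
Proof.
pose g := gamma_integrand (1 / 2).
have dsq (x : R) : is_derive x 1 (fun t : R => t ^+ 2) (2 * x).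
  apply: is_derive_eq; rewrite /GRing.scale/=; ring.
have dsqE : derive1 (fun t : R => t ^+ 2) = (fun x => 2 * x).
  by apply/funext => x; rewrite derive1E; have /@derive_val -> := dsq x.
have csq (x : R) : {for x, continuous (fun t : R => t ^+ 2)}.
  exact: exprn_continuous.
have c2 (x : R) : {for x, continuous (fun t : R => 2 * t)}.
  by apply: cvgMr; exact: cvg_id.
have sub (a b : R) : 0 < a -> a <= b ->
    (\int[mu]_(t in `[(a ^+ 2)%R, (b ^+ 2)%R]) (g t)%:E =
     \int[mu]_(x in `[a, b]) (2 * gauss_fun x)%:E)%E.
  move=> a0 ab.
  rewrite (@integration_by_substitution_increasing _ (fun t : R => t ^+ 2) g a b ab).
  - apply: eq_integral => x; rewrite inE/= in_itv/= => /andP[ax _].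
    have x0 : 0 < x := lt_le_trans a0 ax.
    rewrite dsqE; congr _%:E; transitivity (g (x ^+ 2) * (2 * x)); first by [].
    rewrite /g /gamma_integrand /gauss_fun.
    have -> : 1 / 2 - 1 = - (2^-1) :> R by lra.
    rewrite powRN powR12_sqrt ?sqr_ge0// sqrtr_sqr gtr0_norm//.
    by field; rewrite gt_eqF.
  - move=> x y; rewrite !in_itv/= => /andP[ax _] /andP[ay _] xy.
    by rewrite ltr_pXn2r// nnegrE ltW// (lt_le_trans a0).
  - by rewrite dsqE => x _; exact: c2.
  - by rewrite dsqE; apply/cvg_ex; exists (2 * a); apply: cvg_at_right_filter; exact: c2.
  - by rewrite dsqE; apply/cvg_ex; exists (2 * b); apply: cvg_at_left_filter; exact: c2.
  - split; first by move=> x _; exact: ex_derive.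
      by apply: cvg_at_right_filter; exact: csq.
    by apply: cvg_at_left_filter; exact: csq.
  - apply: derivable_within_continuous => x; rewrite in_itv/= => /andP[ax _].
    have x0 : 0 < x by apply: lt_le_trans ax; rewrite exprn_gt0.
    apply: derivableM; last exact: ex_derive.
    by apply: ex_derive; exact: is_derive1_powR.
have ip n : 0 < n.+1%:R^-1 :> R by rewrite invr_gt0.
have cg : (\int[mu]_(t in `[(n.+1%:R^-1 ^+ 2)%R, (n.+1%:R ^+ 2)%R]) (g t)%:E)%E
    @[n --> \oo] --> (\int[mu]_(t in `]0%R, +oo[) (g t)%:E)%E.
  apply: cvg_integral_exhaust.
  - by move=> n; rewrite exprn_gt0.
  - by move=> m n mn; rewrite lerXn2r ?nnegrE ?(ltW (ip _))// inv_homo.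
  - by move=> m n mn; rewrite lerXn2r ?nnegrE// nat_homo.
  - move=> x x0; have [n /andP[n1 n2]] := exhaust x0; exists n.
    have i1 : n.+1%:R^-1 <= 1 :> R by rewrite invf_le1// ler1n.
    apply/andP; split.
      by apply: le_trans n1; rewrite expr2 ler_piMr// ltW.
    by apply: (le_trans n2); rewrite expr2 ler_peMr// ler1n.
  - exact: measurable_gamma_integrand.
  - by move=> x _; exact: gamma_integrand_ge0.
have ch : (\int[mu]_(x in `[n.+1%:R^-1%R, n.+1%:R]) (2 * gauss_fun x)%:E)%E
    @[n --> \oo] --> (\int[mu]_(x in `]0%R, +oo[) (2 * gauss_fun x)%:E)%E.
  apply: (cvg_integral_exhaust ip inv_homo nat_homo exhaust).
    apply: measurable_funM; first exact: measurable_cst.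
    by apply: measurable_funTS; exact: measurable_gauss_fun.
  by move=> x _; rewrite mulr_ge0// gauss_fun_ge0.
have E : (\int[mu]_(t in `]0%R, +oo[) (g t)%:E =
     \int[mu]_(t in `]0%R, +oo[) (2 * gauss_fun t)%:E)%E.
  apply: (cvg_unique (@ereal_hausdorff R) cg) => /=.
  have -> : (fun n : nat => \int[mu]_(x in `[(n.+1%:R^-1 ^+ 2)%R, (n.+1%:R ^+ 2)%R])
      (g x)%:E)%E
    = (fun n : nat => \int[mu]_(x in `[n.+1%:R^-1%R, n.+1%:R]) (2 * gauss_fun x)%:E)%E.
    apply/funext => n; rewrite sub//.
    by apply: (@le_trans _ _ 1); [rewrite invf_le1// ler1n|rewrite ler1n].
  exact: ch.
rewrite /Gamma /Rintegral [X in fine X]E.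
under eq_integral do rewrite EFinM.
rewrite ge0_integralZl_EFin//; last 2 first.
  by move=> x _; rewrite lee_fin gauss_fun_ge0.
  by apply/measurable_EFinP/measurable_funTS; exact: measurable_gauss_fun.
rewrite integral_itv_obnd_cbnd; last first.
  by apply/measurable_EFinP/measurable_funTS; exact: measurable_gauss_fun.
by rewrite integral0y_gauss -EFinM/= mulrC divfK.
Qed.

(** Both sides satisfy the Wallis recurrence. *)
Lemma Gamma_ratio (d : nat) :
  Gamma (d.+1%:R / 2) / Gamma (d.+2%:R / 2) = Num.sqrt pi * wallis R d.
Proof.
have rec k : Gamma (k.+3%:R / 2) = k.+1%:R / 2 * Gamma (k.+1%:R / 2) :> R.
  rewrite -GammaS ?divr_gt0//; congr Gamma.
  by rewrite -[k.+3%:R]natr1 -[k.+2%:R]natr1; lra.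
have pi0 := pi_gt0 R.
have s0 : Num.sqrt pi != 0 :> R by rewrite gt_eqF// sqrtr_gt0.
elim/ltn_ind: d => -[_|[_|d IH]].
- by rewrite Gamma_half divff// Gamma1 divr1 mulr1.
- rewrite rec divff// Gamma1 Gamma_half /=.
  rewrite -[in 2 / pi](sqr_sqrtr (ltW pi0)).
  by field.
- rewrite wallisSS !rec mulrCA -IH// invfM.
  move: (Gamma _) (Gamma _)^-1 => x y.
  have := pnatr_eq0 R d.+2; move: (d.+1%:R : R) (d.+2%:R : R) => p q /= q0.
  by field; rewrite q0.
Qed.

End GammaHalfIntegers.

(** * The coherence bound and its limit *)

Section Bound.
Variable R : realType.

Lemma coherence_boundE d N : coherence_bound R d.+2 N =
  cos (pi * (d.+1%:R * wallis R d / N%:R) `^ d.+1%:R^-1).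
Proof.
have E : d.+2%:R - 1 = d.+1%:R :> R by rewrite -[d.+2%:R]natr1 addrK.
rewrite /coherence_bound E Gamma_ratio div1r; congr (cos (_ * _ `^ _)).
have s0 : Num.sqrt pi != 0 :> R by rewrite gt_eqF// sqrtr_gt0 pi_gt0.
by rewrite invfM; move: N%:R^-1 (wallis R d) => y w; field.
Qed.

Lemma cos_le (x y : R) : 0 <= x -> x <= y -> y <= pi -> cos y <= cos x.
Proof.
move=> x0; rewrite le_eqVlt => /predU1P[->//|xy] yp.
by rewrite ltW// ltr_cos ?in_itv//=; apply/andP; split; lra.
Qed.

(** When the coherence is at least 1 there is nothing to pack, and the bound is
    a cosine. *)
Lemma coherence_bound_le M N (Phi : 'M[R]_(M, N)) : (2 <= M)%N -> (M <= N)%N ->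
  (forall j, l2norm (col j Phi) = 1) ->
  coherence_bound R M N <= worst_case_coherence Phi.
Proof.
case: M Phi => [//|[//|d]] Phi _ dN unit1; rewrite coherence_boundE.
have phi1 j : dotp (col j Phi) (col j Phi) = 1.
  by rewrite -[LHS]sqr_sqrtr ?dotp_ge0// -/(l2norm _) unit1 expr1n.
set mu := worst_case_coherence Phi.
have mu0 : 0 <= mu by exact: bigmax_ge_id.
have phi_mu i j : i != j -> `|dotp (col i Phi) (col j Phi)| <= mu.
  move=> ij; rewrite /mu /worst_case_coherence.
  exact: (@le_bigmax_cond _ _ _ _ (i, j) (fun p => p.1 != p.2)
    (fun p => `|dotp (col p.1 Phi) (col p.2 Phi)|)).
case: (ltP mu 1) => [mu1|mu1]; last by apply: le_trans mu1; exact: cos_le1.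
have mu01 : 0 <= mu < 1 by rewrite mu0.
have muI : -1 <= mu <= 1 by apply/andP; split; lra.
have pack := cap_packing phi1 phi_mu mu01.
have pi0 := pi_gt0 R.
have N0 : 0 < N%:R :> R by rewrite ltr0n; apply: leq_trans dN.
have D0 : 0 < d.+1%:R :> R by [].
set X := d.+1%:R * wallis R d / N%:R.
have X0 : 0 <= X by rewrite !(divr_ge0, mulr_ge0)// ltW// wallis_gt0.
have X1 : X <= 1.
  rewrite ler_pdivrMr// mul1r (@le_trans _ _ d.+1%:R)//.
    by rewrite ler_piMr// wallis_le1.
  by rewrite ler_nat ltnW.
have theta0 : 0 <= acos mu / pi by rewrite divr_ge0 ?acos_ge0// ltW.
have thX : (acos mu / pi) ^+ d.+1 <= X.
  by rewrite ler_pdivlMr// mulrC [leRHS]mulrC -ler_pdivrMr// -mulrA.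
have root : acos mu / pi <= X `^ d.+1%:R^-1.
  have -> : acos mu / pi = ((acos mu / pi) ^+ d.+1) `^ d.+1%:R^-1.
    by rewrite -powR_mulrn// -powRrM divff ?powRr1// pnatr_eq0.
  by apply: ge0_ler_powR; rewrite ?nnegrE ?invr_ge0 ?exprn_ge0.
have B1 : X `^ d.+1%:R^-1 <= 1.
  have := ge0_ler_powR (_ : 0 <= d.+1%:R^-1 :> R) _ _ X1.
  by rewrite powR1; apply; rewrite ?nnegrE ?invr_ge0.
rewrite -[leRHS](@acosK R mu) ?in_itv//; apply: cos_le.
- exact: acos_ge0.
- by rewrite mulrC -ler_pdivrMr.
- by rewrite ler_piMr// ltW.
Qed.

(** From [ln x = 2 * ln (sqrt x) <= 2 * sqrt x]. *)
Lemma cvg_ln_div : ln n.+1%:R / n.+1%:R @[n --> \oo] --> (0 : R).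
Proof.
have c : 2 * Num.sqrt (n.+1%:R^-1) @[n --> \oo] --> (0 : R).
  rewrite -[X in _ --> X](mulr0 2) -(@sqrtr0 R); apply: cvgZr.
  apply: continuous_cvg; first exact: sqrt_continuous.
  exact: cvg_harmonic.
apply: (squeeze_cvgr _ (cvg_cst 0) c).
near=> n; have n0 : 0 < n.+1%:R :> R by [].
rewrite divr_ge0 ?ln_ge0 ?ler1n//= sqrtrV ?(ltW n0)//.
have s0 : 0 < Num.sqrt n.+1%:R :> R by rewrite sqrtr_gt0.
rewrite -[in ln _](sqr_sqrtr (ltW n0)) -[X in _ / X](sqr_sqrtr (ltW n0)) lnXn//.
rewrite expr2 invfM mulrA ler_pM2r ?invr_gt0// ler_pdivrMr// mulr2n.
have := ln_sublinear s0; lra.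
Unshelve. all: by end_near. Qed.

(** In logarithms: [ln N] is [M * ln a] up to a bounded error, and the logarithm
    of the other factor is at most [ln M] in absolute value up to a constant; both
    errors vanish after division by [M - 1]. *)
Lemma cvg_coherence_bound (a k1 k2 : R) (N : nat -> nat) : 1 < a -> 0 < k1 -> 0 < k2 ->
  (\forall M \near \oo, k1 * a ^+ M <= (N M)%:R <= k2 * a ^+ M) ->
  coherence_bound R M (N M) @[M --> \oo] --> cos (pi / a).
Proof.
move=> a1 k10 k20 HN.
have a0 : 0 < a by apply: lt_trans a1.
have pi0 := pi_gt0 R.
rewrite -(cvg_shiftn 2) /=.
pose X d := d.+1%:R * wallis R d / (N d.+2)%:R.
pose c1 := ln (2 / pi) - ln k2 - ln a.
pose c2 := - ln k1 - ln a.
have cstdiv (c : R) : c / n.+1%:R @[n --> \oo] --> (0 : R).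
  by rewrite -[X in _ --> X](mulr0 c); apply: cvgZr; exact: cvg_harmonic.
have low : c1 / n.+1%:R - ln a @[n --> \oo] --> - ln a.
  by rewrite -[X in _ --> X]add0r; apply: cvgD => //; exact: cvg_cst.
have high : (ln n.+1%:R / n.+1%:R + c2 / n.+1%:R) - ln a @[n --> \oo] --> - ln a.
  rewrite -[X in _ --> X]add0r; apply: cvgD; last exact: cvg_cst.
  by rewrite -[X in _ --> X]addr0; apply: cvgD => //; exact: cvg_ln_div.
have HN2 : \forall d \near \oo, k1 * a ^+ d.+2 <= (N d.+2)%:R <= k2 * a ^+ d.+2.
  have [m _ Hm] := HN; exists m => // d /= md; apply: Hm => /=.
  by rewrite (leq_trans md)// !leqW.
have Xpos : \forall d \near \oo, 0 < X d.
  near=> d; have /andP[H _] : k1 * a ^+ d.+2 <= (N d.+2)%:R <= k2 * a ^+ d.+2.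
    by near: d.
  rewrite divr_gt0 ?mulr_gt0 ?wallis_gt0//.
  by apply: lt_le_trans H; rewrite mulr_gt0// exprn_gt0.
have lnX : d.+1%:R^-1 * ln (X d) @[d --> \oo] --> - ln a.
  apply: (squeeze_cvgr _ low high); near=> d.
  have X0 : 0 < X d by near: d.
  have /andP[H1 H2] : k1 * a ^+ d.+2 <= (N d.+2)%:R <= k2 * a ^+ d.+2.
    by near: d.
  have D0 : 0 < d.+1%:R :> R by [].
  have ad0 : 0 < a ^+ d.+2 by rewrite exprn_gt0.
  have N0 : 0 < (N d.+2)%:R :> R.
    by apply: lt_le_trans H1; rewrite mulr_gt0.
  have lnad : ln (a ^+ d.+2) = d.+1%:R * ln a + ln a.
    by rewrite lnXn// mulrS addrC mulr_natl.
  have ka1 : 0 < k1 * a ^+ d.+2 by exact: mulr_gt0.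
  have ka2 : 0 < k2 * a ^+ d.+2 by exact: mulr_gt0.
  have w0 := wallis_gt0 R d.
  have L : 2 / pi / (k2 * a ^+ d.+2) <= X d.
    apply: ler_pM; [by rewrite divr_ge0// ltW|by rewrite invr_ge0 ltW| |].
      by rewrite [leRHS]mulrC -ler_pdivrMr// wallis_ge.
    by rewrite lef_pV2 ?posrE.
  have U : X d <= d.+1%:R / (k1 * a ^+ d.+2).
    apply: ler_pM; [by rewrite mulr_ge0// ltW|by rewrite invr_ge0| |].
      by rewrite ler_piMr// wallis_le1.
    by rewrite lef_pV2 ?posrE.
  have tp : 0 < 2 / pi :> R by rewrite divr_gt0.
  have lnL : c1 - d.+1%:R * ln a <= ln (X d).
    have -> : c1 - d.+1%:R * ln a = ln (2 / pi / (k2 * a ^+ d.+2)).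
      by rewrite ln_div ?posrE// (lnM (x := k2)) ?posrE// lnad /c1; ring.
    by rewrite ler_ln ?posrE// divr_gt0.
  have lnU : ln (X d) <= ln d.+1%:R + c2 - d.+1%:R * ln a.
    have -> : ln d.+1%:R + c2 - d.+1%:R * ln a = ln (d.+1%:R / (k1 * a ^+ d.+2)).
      by rewrite ln_div ?posrE// (lnM (x := k1)) ?posrE// lnad /c2; ring.
    by rewrite ler_ln ?posrE// divr_gt0.
  clearbody c1 c2; rewrite [_^-1 * _]mulrC ler_pdivlMr// ler_pdivrMr//.
  rewrite !mulrBl !mulrDl !mulfVK ?gt_eqF//.
  by apply/andP; split; [move: lnL|move: lnU]; rewrite (mulrC _ (ln a)).
have cB : X d `^ d.+1%:R^-1 @[d --> \oo] --> a^-1.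
  have -> : a^-1 = expR (- ln a) by rewrite expRN lnK.
  apply: (@cvg_trans _ (expR (d.+1%:R^-1 * ln (X d)) @[d --> \oo])).
    by apply: near_eq_cvg; near=> d; rewrite /powR gt_eqF//; near: d.
  by apply: continuous_cvg; [exact: continuous_expR|exact: lnX].
apply: (@cvg_trans _ (cos (pi * X d `^ d.+1%:R^-1) @[d --> \oo])).
  by apply: near_eq_cvg; near=> d; rewrite addn2 coherence_boundE.
apply: continuous_cvg; first exact: continuous_cos.
exact: cvgZr.
Unshelve. all: by end_near. Qed.

End Bound.

Theorem theorem64 (R : realType) :
  (forall (M N : nat) (Phi : 'M[R]_(M, N)),
     (2 <= M)%N -> (M <= N)%N -> unit_norm_frame Phi ->
     coherence_bound R M N <= worst_case_coherence Phi)
  /\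
  (forall (a : R) (N : nat -> nat),
     1 < a ->
     (fun M : nat => (N M)%:R : R) =Theta_\oo (fun M : nat => a ^+ M) ->
     coherence_bound R M (N M) @[M --> \oo] --> cos (pi / a)).
Proof.
split=> [M N Phi M2 MN [_ unit1]|a N a1]; first exact: coherence_bound_le.
rewrite eqThetaE qualifE => /asboolP[[k1 k2] /= /andP[k10 k20] H].
apply: (cvg_coherence_bound a1 k10 k20).
apply: filterS H => M; rewrite normr_nat ger0_norm ?exprn_ge0 ?(ltW (lt_trans _ a1))//.
by move=> [-> ->].
Qed.
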